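(* Let $D_1=\{(a,b): a,b>0,\ ab\le 1/4\}$ and $D_2=\{(a,b): a,b>0,\ 1/a+1/b\le 4\}$, and for $a,b>0$ put $k(r)=F(a,b;a+b;r^2)$, $r\in(0,1)$. For each $r\in(0,1)$ and $(a,b)\in D_1$, $$\frac{\pi}{B(a,b)}\,k(r)<k\bigl(2\sqrt{r}/(1+r)\bigr)<2k(r).$$ For each $r\in(0,1)$ and $(a,b)\in D_2$, $$k(r)<k\bigl(2\sqrt{r}/(1+r)\bigr)<\frac{2\pi}{B(a,b)}\,k(r).$$
   Context: For real $a,b,c$ with $c\ne 0,-1,-2,\dots$, the Gaussian hypergeometric function is $F(a,b;c;x)=\sum_{n=0}^\infty \frac{(a,n)(b,n)}{(c,n)}\frac{x^n}{n!}$ for $x\in(-1,1)$, where $(a,n)=a(a+1)\cdots(a+n-1)$ for $n\ge 1$ and $(a,0)=1$. $B(a,b)=\Gamma(a)\Gamma(b)/\Gamma(a+b)$ is the classical beta function. Here $a,b$ are real numbers. *)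

(* Defs.v *)
From Stdlib Require Import Reals Factorial.
From Coquelicot Require Import Coquelicot.

Open Scope R_scope.

(* (a,n) = a (a+1) ... (a+n-1), with (a,0) = 1. *)
Fixpoint poch (a : R) (n : nat) : R :=
  match n with
  | O => 1
  | S m => poch a m * (a + INR m)
  end.

(* Meaningful for c <> 0, -1, -2, ... and |x| < 1. *)
Definition hypergeom (a b c x : R) : R :=
  PSeries (fun n => poch a n * poch b n / poch c n / INR (fact n)) x.

(* Euler's integral over (0, +oo), improper at both ends; meaningful for s > 0. *)
Definition Gamma (s : R) : R :=
  RInt_gen (fun t => Rpower t (s - 1) * exp (- t))
    (at_right 0) (Rbar_locally p_infty).

Definition Beta (a b : R) : R := Gamma a * Gamma b / Gamma (a + b).

Definition D1 (a b : R) : Prop := 0 < a /\ 0 < b /\ a * b <= 1 / 4.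

Definition D2 (a b : R) : Prop := 0 < a /\ 0 < b /\ 1 / a + 1 / b <= 4.

Definition kfun (a b r : R) : R := hypergeom a b (a + b) (r ^ 2).

(* Main.v *)
Require Import Defs.
From Stdlib Require Import Reals Lra Lia Classical Wf_nat Factorial.
From Coquelicot Require Import Coquelicot.

Open Scope R_scope.

(** Write [K(x) = F(1/2,1/2;1;x)], [c_n] for the coefficients of
    [F(a,b;a+b;x)] and [d_n] for those of [K]. The whole statement is a
    comparison with [K], for which Landen's transformation
    [K(4r/(1+r)^2) = (1+r) K(r^2)] gives the exact growth between the two
    arguments [x = r^2] and [y = 4r/(1+r)^2], a factor strictly between 1 and 2.

    The step [c_(n+1)/d_(n+1) - c_n/d_n] has the sign of a linear function of
    [n] whose two coefficients are nonpositive on [D1] and nonnegative on [D2]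
    ([coef_quotient_step]). So [c_n/d_n] starts at 1 and moves monotonically to
    its limit, which is [PI/B(a,b)] because [n c_n -> 1/B(a,b)]
    ([is_lim_coef]) and [n d_n -> 1/PI] ([is_lim_dcoef]). Hence every [c_n]
    lies between [d_n] and [(PI/B) d_n], and so does [k] with respect to [K].
    Three of the bounds follow at once:
    - on [D1], [(PI/B) k(x) <= (PI/B) K(x) < (PI/B) K(y) <= k(y)];
    - on [D2], [k(y) <= (PI/B) K(y) < 2 (PI/B) K(x) <= 2 (PI/B) k(x)];
    - on [D2], [k(x) < k(y)], as the coefficients are positive.
    The same chain would cost the upper bound on [D1] a factor [B/PI]; there one
    uses that the quotient [k/K] itself decreases when [c_n/d_n] does
    ([PSeries_quotient_decreasing]): [k(y) <= (k(x)/K(x)) K(y) < 2 k(x)].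

    Landen's transformation holds because both sides solve the same
    second-order equation and are regular at its singular point 0, so that
    their weighted Wronskian vanishes. The limit of [n c_n] comes from
    [Gamma(x+a) ~ x^a Gamma(x)], which follows from the inequality
    [t^a <= 1 - a + a t] for [0 <= a <= 1] integrated against the Gamma
    density; the limit of [n d_n] is Wallis's product. *)

(** * Comparison of power series *)

Lemma decreasing_of_step : forall u : nat -> R,
  (forall n, u (S n) <= u n) -> forall n m, (n <= m)%nat -> u m <= u n.
Proof.
  intros u Hu n m H. induction H as [|m H IH]; [lra|]. specialize (Hu m). lra.
Qed.

Lemma term_le_Series : forall (a : nat -> R) (n : nat),
  (forall k, 0 <= a k) -> ex_series a -> a n <= Series a.
Proof.
  intros a n Ha Ea.
  apply Rle_trans with (sum_n a n).
  - destruct n as [|n]; [rewrite sum_O; lra|].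
    rewrite sum_Sn. unfold plus; simpl.
    assert (0 <= sum_n a n); [|lra].
    clear Ea. induction n as [|n IH]; [rewrite sum_O; apply Ha|].
    rewrite sum_Sn. unfold plus; simpl. specialize (Ha (S n)). lra.
  - apply (is_lim_seq_incr_compare (sum_n a)).
    + exact (Series_correct a Ea).
    + intro k. rewrite sum_Sn. unfold plus; simpl. specialize (Ha (S k)). lra.
Qed.

Lemma Series_nonneg : forall a : nat -> R,
  (forall k, 0 <= a k) -> ex_series a -> 0 <= Series a.
Proof.
  intros a Ha Ea.
  apply Rle_trans with (a O); [apply Ha | exact (term_le_Series a O Ha Ea)].
Qed.

Lemma Series_nonpos : forall a : nat -> R,
  (forall k, a k <= 0) -> ex_series a -> Series a <= 0.
Proof.
  intros a Ha Ea.
  assert (H : 0 <= Series (fun n => - a n)).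
  { apply Series_nonneg; [intro k; specialize (Ha k); lra|].
    apply (ex_series_opp a Ea). }
  rewrite Series_opp in H. lra.
Qed.

Lemma PSeries_le : forall (a b : nat -> R) (x : R),
  0 <= x -> (forall n, a n <= b n) -> ex_pseries a x -> ex_pseries b x ->
  PSeries a x <= PSeries b x.
Proof.
  intros a b x Hx Hab Ea Eb.
  assert (H : 0 <= PSeries (PS_minus b a) x).
  { apply Series_nonneg.
    - intro k. unfold PS_minus, PS_plus, PS_opp, plus, opp; simpl.
      apply Rmult_le_pos; [specialize (Hab k); lra | apply pow_le, Hx].
    - apply (proj1 (ex_pseries_R _ _)), ex_pseries_minus; assumption. }
  rewrite PSeries_minus in H by assumption. lra.
Qed.

Lemma PSeries_pos : forall (a : nat -> R) (x : R),
  (forall n, 0 < a n) -> 0 <= x -> ex_pseries a x -> 0 < PSeries a x.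
Proof.
  intros a x Ha Hx Ea.
  apply Rlt_le_trans with (a O * x ^ 0).
  - simpl. specialize (Ha O). lra.
  - apply (term_le_Series (fun n => a n * x ^ n)).
    + intro k. apply Rmult_le_pos; [apply Rlt_le, Ha | apply pow_le, Hx].
    + apply (proj1 (ex_pseries_R _ _)), Ea.
Qed.

Lemma PSeries_increasing : forall (a : nat -> R) (x y : R),
  (forall n, 0 < a n) -> 0 <= x < y -> ex_pseries a x -> ex_pseries a y ->
  PSeries a x < PSeries a y.
Proof.
  intros a x y Ha Hxy Ex Ey.
  assert (H : a 1%nat * y ^ 1 - a 1%nat * x ^ 1
              <= Series (fun n => a n * y ^ n - a n * x ^ n)).
  { apply (term_le_Series (fun n => a n * y ^ n - a n * x ^ n)).
    - intro k. assert (x ^ k <= y ^ k) by (apply pow_incr; lra).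
      specialize (Ha k). nra.
    - apply (ex_series_minus (V := R_NormedModule)); apply (proj1 (ex_pseries_R _ _)); assumption. }
  rewrite Series_minus in H by (apply (proj1 (ex_pseries_R _ _)); assumption).
  fold (PSeries a y) (PSeries a x) in H.
  unfold PSeries in *. specialize (Ha 1%nat). simpl in H. nra.
Qed.

(** If the coefficients change sign at most once, from + to -, and the series
    vanishes at [x], then moving right to [y] weighs the negative tail more:
    compared with the common factor [(y/x)^N] at the crossing index [N], each
    term can only decrease. *)
Lemma PSeries_single_crossing : forall (e : nat -> R) (x y : R),
  0 < x < y -> (forall n m, (n <= m)%nat -> e n <= 0 -> e m <= 0) ->
  ex_pseries e x -> ex_pseries e y ->
  PSeries e x = 0 -> PSeries e y <= 0.
Proof.
  intros e x y Hxy He Ex Ey H0.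
  apply (proj1 (ex_pseries_R _ _)) in Ex. apply (proj1 (ex_pseries_R _ _)) in Ey.
  destruct (classic (exists n, e n <= 0)) as [Hneg|Hpos].
  - destruct (dec_inh_nat_subset_has_unique_least_element (fun n => e n <= 0))
      as [N [[HN Hmin] _]].
    { intro n. destruct (Rle_dec (e n) 0); [left|right]; assumption. }
    { exact Hneg. }
    assert (Hq : 1 < y / x).
    { apply Rmult_lt_reg_r with x; [lra|].
      unfold Rdiv. rewrite Rmult_assoc, Rinv_l by lra. lra. }
    assert (H : Series (fun n => e n * y ^ n - (y / x) ^ N * (e n * x ^ n)) <= 0).
    { apply Series_nonpos.
      - intro k.
        replace (y ^ k) with ((y / x) ^ k * x ^ k).
        2:{ rewrite <- Rpow_mult_distr. f_equal. field. lra. }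
        replace (e k * ((y / x) ^ k * x ^ k) - (y / x) ^ N * (e k * x ^ k))
          with (x ^ k * (e k * ((y / x) ^ k - (y / x) ^ N))) by ring.
        assert (0 < x ^ k) by (apply pow_lt; lra).
        assert (e k * ((y / x) ^ k - (y / x) ^ N) <= 0); [|nra].
        destruct (Nat.le_gt_cases N k) as [HNk|HNk].
        + assert (e k <= 0) by (apply (He N); assumption).
          assert ((y / x) ^ N <= (y / x) ^ k) by (apply Rle_pow; [lra|lia]).
          nra.
        + assert (0 <= e k).
          { apply Rnot_lt_le. intro C.
            assert (N <= k)%nat by (apply Hmin; lra). lia. }
          assert ((y / x) ^ k <= (y / x) ^ N) by (apply Rle_pow; [lra|lia]).
          nra.
      - apply (ex_series_minus (V := R_NormedModule)); [exact Ey|].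
        apply (ex_series_scal (V := R_NormedModule)), Ex. }
    rewrite Series_minus, Series_scal_l in H.
    + unfold PSeries in *. rewrite H0 in H. lra.
    + exact Ey.
    + apply (ex_series_scal (V := R_NormedModule)), Ex.
  - exfalso.
    assert (Hall : forall n, 0 < e n).
    { intro n. apply Rnot_le_lt. intro C. apply Hpos. exists n. exact C. }
    assert (0 < PSeries e x); [|lra].
    apply PSeries_pos; [exact Hall | lra | apply (proj2 (ex_pseries_R _ _)), Ex].
Qed.

(** With [q] the value of the quotient at [x], the coefficients [c n - q * d n]
    cross zero at most once, so the quotient of the two series inherits the
    monotonicity of the quotient of their coefficients. *)
Lemma PSeries_quotient_decreasing : forall (c d : nat -> R) (x y : R),
  0 < x < y -> (forall n, 0 < d n) ->
  (forall n m, (n <= m)%nat -> c m / d m <= c n / d n) ->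
  ex_pseries c x -> ex_pseries c y -> ex_pseries d x -> ex_pseries d y ->
  PSeries c y <= PSeries c x / PSeries d x * PSeries d y.
Proof.
  intros c d x y Hxy Hd Hcd Ecx Ecy Edx Edy.
  assert (Hdx : 0 < PSeries d x) by (apply PSeries_pos; [exact Hd | lra | exact Edx]).
  set (q := PSeries c x / PSeries d x).
  assert (Hscal : forall z, ex_pseries d z -> ex_pseries (PS_scal q d) z)
    by (intros z Ez; apply ex_pseries_scal; [apply Rmult_comm | exact Ez]).
  assert (HP : forall z, ex_pseries c z -> ex_pseries d z ->
     PSeries (PS_minus c (PS_scal q d)) z = PSeries c z - q * PSeries d z).
  { intros z Ecz Edz. rewrite PSeries_minus, PSeries_scal; auto. }
  assert (H : PSeries (PS_minus c (PS_scal q d)) y <= 0).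
  { apply PSeries_single_crossing with x; [exact Hxy| | | |].
    - intros n m Hnm.
      unfold PS_minus, PS_plus, PS_opp, PS_scal, plus, opp, scal; simpl.
      unfold mult; simpl. intro Hn.
      specialize (Hcd n m Hnm). pose proof (Hd n). pose proof (Hd m).
      assert (c n / d n <= q).
      { apply Rmult_le_reg_r with (d n); [lra|].
        unfold Rdiv. rewrite Rmult_assoc, Rinv_l by lra. lra. }
      assert (c m = c m / d m * d m) by (field; lra).
      assert (c m / d m <= q) by lra. nra.
    - apply ex_pseries_minus; auto.
    - apply ex_pseries_minus; auto.
    - rewrite HP by assumption. unfold q. field. lra. }
  rewrite HP in H by assumption. lra.
Qed.

(** * The zero-balanced hypergeometric coefficients *)

(** The Maclaurin coefficients of [F(a,b;a+b;x)]. *)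
Definition coef (a b : R) (n : nat) : R :=
  poch a n * poch b n / poch (a + b) n / INR (fact n).

Notation dcoef := (coef (1/2) (1/2)).

Lemma poch_pos : forall a n, 0 < a -> 0 < poch a n.
Proof.
  intros a n Ha. induction n as [|n IH]; simpl; [lra|].
  apply Rmult_lt_0_compat; [exact IH|]. pose proof (pos_INR n). lra.
Qed.

Lemma coef_pos : forall a b n, 0 < a -> 0 < b -> 0 < coef a b n.
Proof.
  intros a b n Ha Hb. unfold coef.
  assert (0 < poch a n) by (apply poch_pos; lra).
  assert (0 < poch b n) by (apply poch_pos; lra).
  assert (0 < poch (a + b) n) by (apply poch_pos; lra).
  pose proof (INR_fact_lt_0 n).
  repeat apply Rdiv_lt_0_compat; try assumption. nra.
Qed.

Lemma coef_0 : forall a b, coef a b 0 = 1.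
Proof. intros. unfold coef. simpl. field. Qed.

Lemma coef_S : forall a b n, 0 < a -> 0 < b ->
  coef a b (S n) = coef a b n *
    ((a + INR n) * (b + INR n) / ((a + b + INR n) * (INR n + 1))).
Proof.
  intros a b n Ha Hb. unfold coef. rewrite fact_simpl, mult_INR, S_INR. simpl poch.
  assert (0 < poch (a + b) n) by (apply poch_pos; lra).
  pose proof (INR_fact_lt_0 n). pose proof (pos_INR n).
  field. repeat split; lra.
Qed.

Lemma is_lim_seq_inv_INR_S : is_lim_seq (fun n => / (INR n + 1)) 0.
Proof.
  apply is_lim_seq_ext with (fun n => / INR (S n)).
  - intro n. rewrite S_INR. reflexivity.
  - apply (is_lim_seq_incr_1 (fun n => / INR n)).
    apply (is_lim_seq_inv INR p_infty); [apply is_lim_seq_INR | discriminate].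
Qed.

Lemma CV_radius_coef : forall a b, 0 < a -> 0 < b -> CV_radius (coef a b) = 1.
Proof.
  intros a b Ha Hb.
  replace (Finite 1) with (Finite (/ 1)) by (f_equal; field).
  apply CV_radius_finite_DAlembert; [|lra|].
  { intro n. pose proof (coef_pos a b n Ha Hb). lra. }
  apply is_lim_seq_ext with
    (fun n => 1 - (1 - a * b / (a + b + INR n)) * / (INR n + 1)).
  { intro n. pose proof (coef_pos a b n Ha Hb). pose proof (pos_INR n).
    rewrite coef_S by assumption.
    assert (0 < (a + INR n) * (b + INR n) / ((a + b + INR n) * (INR n + 1))).
    { apply Rdiv_lt_0_compat; apply Rmult_lt_0_compat; lra. }
    rewrite Rabs_pos_eq.
    - field. repeat split; lra.
    - replace (coef a b n * _ / coef a b n)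
        with ((a + INR n) * (b + INR n) / ((a + b + INR n) * (INR n + 1)))
        by (field; repeat split; lra).
      lra. }
  assert (Hlim : is_lim_seq (fun n => (1 + a * b / (a + b)) * / (INR n + 1)) 0).
  { replace (Finite 0) with (Rbar_mult (1 + a * b / (a + b)) 0)
      by (simpl; f_equal; ring).
    apply is_lim_seq_scal_l, is_lim_seq_inv_INR_S. }
  assert (L : is_lim_seq (fun n => (1 - a * b / (a + b + INR n)) * / (INR n + 1)) 0).
  { apply is_lim_seq_le_le with
      (fun n => - ((1 + a * b / (a + b)) * / (INR n + 1)))
      (fun n => (1 + a * b / (a + b)) * / (INR n + 1)).
    - intro n. pose proof (pos_INR n).
      assert (0 < / (INR n + 1)) by (apply Rinv_0_lt_compat; lra).
      assert (0 < a * b) by nra.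
      assert (0 < a * b / (a + b + INR n)) by (apply Rdiv_lt_0_compat; lra).
      assert (a * b / (a + b + INR n) <= a * b / (a + b)).
      { apply Rmult_le_compat_l; [lra|]. apply Rinv_le_contravar; lra. }
      split; nra.
    - replace (Finite 0) with (Rbar_opp 0) by (simpl; f_equal; ring).
      apply (proj1 (is_lim_seq_opp _ 0)), Hlim.
    - exact Hlim. }
  replace (Finite 1) with (Finite (1 - 0)) by (f_equal; ring).
  apply is_lim_seq_minus'; [apply is_lim_seq_const | exact L].
Qed.

Lemma ex_pseries_coef : forall a b x, 0 < a -> 0 < b -> 0 <= x < 1 ->
  ex_pseries (coef a b) x.
Proof.
  intros a b x Ha Hb Hx. apply CV_radius_inside.
  rewrite CV_radius_coef by assumption. simpl. rewrite Rabs_pos_eq; lra.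
Qed.

(** Cross-multiplying the two recursions leaves the linear expression
    [(ab - 1/4) n + (ab - (a+b)/4)]; the conditions defining the two parameter
    domains control the sign of both of its coefficients. *)
Lemma coef_quotient_step : forall a b n, 0 < a -> 0 < b ->
  coef a b (S n) / dcoef (S n) - coef a b n / dcoef n
  = coef a b n / dcoef n *
    (((a * b - 1/4) * INR n + (a * b - (a + b) / 4)) *
     / ((a + b + INR n) * (1/2 + INR n) ^ 2)).
Proof.
  intros a b n Ha Hb.
  rewrite !coef_S by lra.
  assert (0 < dcoef n) by (apply coef_pos; lra).
  pose proof (pos_INR n).
  field. repeat split; try lra.
Qed.

Lemma coef_quotient_step_sign : forall a b n, 0 < a -> 0 < b ->
  0 < coef a b n / dcoef n /\
  0 < / ((a + b + INR n) * (1/2 + INR n) ^ 2).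
Proof.
  intros a b n Ha Hb. pose proof (pos_INR n). split.
  - apply Rdiv_lt_0_compat; apply coef_pos; lra.
  - apply Rinv_0_lt_compat, Rmult_lt_0_compat; [lra|]. apply pow_lt. lra.
Qed.

Lemma coef_quotient_decreasing : forall a b n, D1 a b ->
  coef a b (S n) / dcoef (S n) <= coef a b n / dcoef n.
Proof.
  intros a b n (Ha & Hb & Hab).
  pose proof (coef_quotient_step a b n Ha Hb) as E.
  destruct (coef_quotient_step_sign a b n Ha Hb) as [P Q].
  pose proof (pos_INR n).
  (* by AM-GM, (4ab)^2 <= 4ab <= (a+b)^2 *)
  assert (a * b <= (a + b) / 4).
  { assert (0 < a * b) by nra.
    assert (Hsq : (4 * (a * b)) ^ 2 <= (a + b) ^ 2).
    { apply Rle_trans with (4 * (a * b)).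
      - generalize dependent (a * b). intros; nra.
      - pose proof (pow2_ge_0 (a - b)). nra. }
    assert (4 * (a * b) <= a + b); [|lra].
    apply Rsqr_incr_0_var; [|lra]. unfold Rsqr. simpl in Hsq. lra. }
  assert (((a * b - 1/4) * INR n + (a * b - (a + b) / 4)) <= 0) by nra.
  set (X := coef a b n / dcoef n) in *.
  set (u := (a * b - 1/4) * INR n + (a * b - (a + b) / 4)) in *.
  set (v := / ((a + b + INR n) * (1/2 + INR n) ^ 2)) in *.
  assert (u * v <= 0) by nra. nra.
Qed.

Lemma coef_quotient_increasing : forall a b n, D2 a b ->
  coef a b n / dcoef n <= coef a b (S n) / dcoef (S n).
Proof.
  intros a b n (Ha & Hb & Hab).
  pose proof (coef_quotient_step a b n Ha Hb) as E.
  destruct (coef_quotient_step_sign a b n Ha Hb) as [P Q].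
  pose proof (pos_INR n).
  assert (0 < a * b) by nra.
  assert (a + b <= 4 * (a * b)).
  { replace (a + b) with ((1 / a + 1 / b) * (a * b)) by (field; lra). nra. }
  assert (1 <= a + b) by (pose proof (pow2_ge_0 (a - b)); nra).
  assert (0 <= ((a * b - 1/4) * INR n + (a * b - (a + b) / 4))) by nra.
  set (X := coef a b n / dcoef n) in *.
  set (u := (a * b - 1/4) * INR n + (a * b - (a + b) / 4)) in *.
  set (v := / ((a + b + INR n) * (1/2 + INR n) ^ 2)) in *.
  assert (0 <= u * v) by nra. nra.
Qed.

(** * Landen's transformation *)

(** Up to the factor [PI/2], the complete elliptic integral of the first kind in
    terms of the parameter [x = k^2]. *)
Definition Kfun (x : R) : R := PSeries dcoef x.
Definition DKfun (x : R) : R := PSeries (PS_derive dcoef) x.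

Lemma CV_radius_dcoef : CV_radius dcoef = 1.
Proof. apply CV_radius_coef; lra. Qed.

Lemma is_derive_Kfun : forall x, Rabs x < 1 -> is_derive Kfun x (DKfun x).
Proof.
  intros x Hx. apply is_derive_PSeries. rewrite CV_radius_dcoef. exact Hx.
Qed.

(** The hypergeometric equation of [F(1/2,1/2;1;x)] in self-adjoint form
    [(x (1-x) K')' = K/4], read off coefficientwise from
    [(n+1)^2 d_(n+1) = (n+1/2)^2 d_n]. *)
Lemma is_derive_Kfun_flux : forall x, Rabs x < 1 ->
  is_derive (fun x => x * (1 - x) * DKfun x) x (Kfun x / 4).
Proof.
  intros x Hx.
  set (D := PS_derive dcoef).
  assert (RD : CV_radius D = 1) by (unfold D; rewrite CV_radius_derive; apply CV_radius_dcoef).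
  set (q := PS_incr_1 (PS_minus D (PS_incr_1 D))).
  assert (Rq : Rbar_le 1 (CV_radius q)).
  { unfold q. rewrite CV_radius_incr_1.
    eapply Rbar_le_trans; [|apply (CV_radius_plus D (PS_opp (PS_incr_1 D)))].
    rewrite CV_radius_opp, CV_radius_incr_1, RD.
    apply (Rbar_min_case 1 1); apply Rbar_le_refl. }
  assert (Hq : forall y, Rabs y < 1 -> PSeries q y = y * (1 - y) * DKfun y).
  { intros y Hy.
    assert (E : ex_pseries D y) by (apply CV_radius_inside; rewrite RD; exact Hy).
    unfold q. rewrite PSeries_incr_1, PSeries_minus, PSeries_incr_1.
    - unfold DKfun. fold D. ring.
    - exact E.
    - apply ex_pseries_incr_1, E. }
  apply is_derive_ext_loc with (PSeries q).
  { assert (Ho : locally x (fun y => Rabs y < 1)).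
    { apply (open_comp Rabs (fun z => z < 1)).
      - intros z _. apply continuous_Rabs.
      - apply open_lt.
      - exact Hx. }
    revert Ho. apply filter_imp. exact Hq. }
  replace (Kfun x / 4) with (PSeries (PS_derive q) x).
  { apply is_derive_PSeries. eapply Rbar_lt_le_trans; [|exact Rq]. exact Hx. }
  unfold Kfun. replace (PSeries dcoef x / 4) with (/ 4 * PSeries dcoef x) by field.
  rewrite <- PSeries_scal. apply PSeries_ext. intro n.
  unfold PS_derive at 1. unfold q, PS_incr_1, PS_minus, PS_plus, PS_opp, PS_scal.
  unfold plus, opp, scal, zero; simpl; unfold mult; simpl.
  destruct n as [|n]; unfold D, PS_derive.
  - change (1%nat) with (S 0). rewrite !coef_S by lra. simpl. field.
  - change (match n with 0%nat => 1 | S _ => INR n + 1 end) with (INR (S n)).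
    rewrite (coef_S _ _ (S n)) by lra.
    rewrite !S_INR. pose proof (pos_INR n). field. split; lra.
Qed.

Lemma ex_dcoef : forall x, 0 <= x < 1 -> ex_pseries dcoef x.
Proof. intros x Hx. apply ex_pseries_coef; lra. Qed.

Lemma Kfun_pos : forall x, 0 <= x < 1 -> 0 < Kfun x.
Proof.
  intros x Hx. apply PSeries_pos; [|lra|apply ex_dcoef; lra].
  intro n. apply coef_pos; lra.
Qed.

Lemma Landen_arg_bounds : forall r, 0 <= r < 1 -> 0 <= 4 * r / (1 + r) ^ 2 < 1.
Proof.
  intros r Hr. assert (0 < (1 + r) ^ 2) by nra. split.
  - apply Rmult_le_pos; [lra|]. apply Rlt_le, Rinv_0_lt_compat. lra.
  - apply Rmult_lt_reg_r with ((1 + r) ^ 2); [lra|].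
    unfold Rdiv. rewrite Rmult_assoc, Rinv_l by lra. nra.
Qed.

Lemma is_derive_Landen_arg : forall r, 0 <= r < 1 ->
  is_derive (fun r => 4 * r / (1 + r) ^ 2) r (4 * (1 - r) / (1 + r) ^ 3).
Proof.
  intros r Hr. auto_derive.
  - simpl. nra.
  - field. lra.
Qed.

(** [u] and [v] are the two sides of the transformation, [p] is the flux
    [x (1-x) K'(x)] and [g] the weight that makes the equation for [u] and [v]
    self-adjoint. [A] and [B] are [g u'] and [g v'] rewritten through [p], so
    that differentiating them calls only for [p' = K/4] and not for a second
    derivative of [K]. *)
Section Landen.

Let g r := r * (1 - r) / (1 + r).
Let y r := 4 * r / (1 + r) ^ 2.
Let p x := x * (1 - x) * DKfun x.
Let u r := (1 + r) * Kfun (r ^ 2).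
Let v r := Kfun (y r).
Let du r := Kfun (r ^ 2) + (1 + r) * (2 * r * DKfun (r ^ 2)).
Let dv r := 4 * (1 - r) / (1 + r) ^ 3 * DKfun (y r).
Let A r := r * (1 - r) / (1 + r) * Kfun (r ^ 2) + 2 / (1 + r) * p (r ^ 2).
Let B r := p (y r).

Lemma Landen_du : forall r, 0 <= r < 1 -> is_derive u r (du r).
Proof.
  intros r Hr.
  assert (Hsq : is_derive (fun r => r ^ 2) r (2 * r)) by (auto_derive; [trivial | ring]).
  assert (H : is_derive (fun r => Kfun (r ^ 2)) r (2 * r * DKfun (r ^ 2))).
  { apply (is_derive_comp Kfun); [|exact Hsq].
    apply is_derive_Kfun. rewrite Rabs_pos_eq; nra. }
  assert (H1 : is_derive (fun r => 1 + r) r 1) by (auto_derive; [trivial | ring]).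
  unfold u, du.
  replace (Kfun (r ^ 2) + _)
    with (1 * Kfun (r ^ 2) + (1 + r) * (2 * r * DKfun (r ^ 2))) by ring.
  apply (is_derive_mult (fun r => 1 + r) (fun r => Kfun (r ^ 2))); auto.
  intros; apply Rmult_comm.
Qed.

Lemma Landen_dv : forall r, 0 <= r < 1 -> is_derive v r (dv r).
Proof.
  intros r Hr.
  apply (is_derive_comp Kfun); [|apply is_derive_Landen_arg, Hr].
  apply is_derive_Kfun. pose proof (Landen_arg_bounds r Hr).
  unfold y. rewrite Rabs_pos_eq; lra.
Qed.

Lemma Landen_dA : forall r, 0 <= r < 1 ->
  is_derive A r ((1 - r) / (1 + r) ^ 3 * u r).
Proof.
  intros r Hr.
  assert (Hsq : is_derive (fun r => r ^ 2) r (2 * r)) by (auto_derive; [trivial | ring]).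
  assert (Ha : Rabs (r ^ 2) < 1) by (rewrite Rabs_pos_eq; nra).
  assert (HK : is_derive (fun r => Kfun (r ^ 2)) r (2 * r * DKfun (r ^ 2))).
  { apply (is_derive_comp Kfun); [apply is_derive_Kfun, Ha | exact Hsq]. }
  assert (Hp : is_derive (fun r => p (r ^ 2)) r (2 * r * (Kfun (r ^ 2) / 4))).
  { apply (is_derive_comp p); [apply is_derive_Kfun_flux, Ha | exact Hsq]. }
  assert (H1 : is_derive (fun r => r * (1 - r) / (1 + r)) r
                 ((1 - 2 * r - r ^ 2) / (1 + r) ^ 2))
    by (auto_derive; [lra | field; lra]).
  assert (H2 : is_derive (fun r => 2 / (1 + r)) r (- 2 / (1 + r) ^ 2))
    by (auto_derive; [lra | field; lra]).
  unfold A, u.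
  replace ((1 - r) / (1 + r) ^ 3 * ((1 + r) * Kfun (r ^ 2))) with
    (((1 - 2 * r - r ^ 2) / (1 + r) ^ 2 * Kfun (r ^ 2)
      + r * (1 - r) / (1 + r) * (2 * r * DKfun (r ^ 2)))
     + (- 2 / (1 + r) ^ 2 * p (r ^ 2) + 2 / (1 + r) * (2 * r * (Kfun (r ^ 2) / 4)))).
  - apply (is_derive_plus (fun r => r * (1 - r) / (1 + r) * Kfun (r ^ 2))
             (fun r => 2 / (1 + r) * p (r ^ 2))).
    + apply (is_derive_mult (fun r => r * (1 - r) / (1 + r)) (fun r => Kfun (r ^ 2))); auto.
      intros; apply Rmult_comm.
    + apply (is_derive_mult (fun r => 2 / (1 + r)) (fun r => p (r ^ 2))); auto.
      intros; apply Rmult_comm.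
  - unfold p. field. lra.
Qed.

Lemma Landen_dB : forall r, 0 <= r < 1 ->
  is_derive B r ((1 - r) / (1 + r) ^ 3 * v r).
Proof.
  intros r Hr. unfold B, v.
  replace ((1 - r) / (1 + r) ^ 3 * Kfun (y r))
    with (4 * (1 - r) / (1 + r) ^ 3 * (Kfun (y r) / 4)) by (field; lra).
  apply (is_derive_comp p); [|apply is_derive_Landen_arg, Hr].
  apply is_derive_Kfun_flux. pose proof (Landen_arg_bounds r Hr).
  unfold y. rewrite Rabs_pos_eq; lra.
Qed.

Lemma Landen_A : forall r, 0 <= r < 1 -> A r = g r * du r.
Proof. intros r Hr. unfold A, g, du, p. field. lra. Qed.

Lemma Landen_B : forall r, 0 <= r < 1 -> B r = g r * dv r.
Proof. intros r Hr. unfold B, g, dv, p, y. field. lra. Qed.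

(** The weighted Wronskian is constant, and the weight vanishes at the origin. *)
Lemma Landen_Wronskian : forall r, 0 <= r < 1 -> A r * v r - u r * B r = 0.
Proof.
  intros r Hr.
  set (W := fun r => A r * v r - u r * B r).
  assert (dW : forall s, 0 <= s < 1 -> is_derive W s 0).
  { intros s Hs.
    replace 0 with (((1 - s) / (1 + s) ^ 3 * u s * v s + A s * dv s)
      - (du s * B s + u s * ((1 - s) / (1 + s) ^ 3 * v s)))
      by (rewrite Landen_A, Landen_B by lra; field; lra).
    apply (is_derive_minus (fun r => A r * v r) (fun r => u r * B r)).
    - apply (is_derive_mult A v); [apply Landen_dA | apply Landen_dv |]; auto.
      intros; apply Rmult_comm.
    - apply (is_derive_mult u B); [apply Landen_du | apply Landen_dB |]; auto.
      intros; apply Rmult_comm. }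
  assert (W0 : W 0 = 0) by (unfold W, A, B, p, y; field).
  destruct (MVT_gen W 0 r (fun _ => 0)) as [c [_ Hc]].
  - intros s Hs. rewrite Rmin_left, Rmax_right in Hs by lra. apply dW. lra.
  - intros s Hs. rewrite Rmin_left, Rmax_right in Hs by lra.
    apply continuity_pt_filterlim, (ex_derive_continuous W).
    exists 0. apply dW. lra.
  - fold (W r). lra.
Qed.

(** [K (4r/(1+r)^2)] and [(1+r) K (r^2)] solve the same equation
    [(g w')' = (1-r)/(1+r)^3 w] and are both regular at the singular point [0],
    where they agree; so their quotient is constant. *)
Theorem Landen_transformation : forall r, 0 <= r < 1 ->
  Kfun (4 * r / (1 + r) ^ 2) = (1 + r) * Kfun (r ^ 2).
Proof.
  intros r Hr.
  assert (Hv : forall s, 0 <= s < 1 -> 0 < v s)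
    by (intros s Hs; apply Kfun_pos, Landen_arg_bounds, Hs).
  set (Q := fun r => u r / v r).
  assert (dQ : forall s, 0 <= s < 1 ->
             is_derive Q s ((du s * v s - u s * dv s) / v s ^ 2)).
  { intros s Hs. apply (is_derive_div u v).
    - apply Landen_du, Hs.
    - apply Landen_dv, Hs.
    - specialize (Hv s Hs). lra. }
  assert (HQ : Q r = Q 0).
  { destruct (MVT_gen Q 0 r (fun _ => 0)) as [c [_ Hc]]; [| |lra].
    - intros s Hs. rewrite Rmin_left, Rmax_right in Hs by lra.
      assert (E : (du s * v s - u s * dv s) / v s ^ 2 = 0).
      { assert (Hs' : 0 <= s < 1) by lra.
        pose proof (Landen_Wronskian s Hs') as HW.
        rewrite Landen_A, Landen_B in HW by lra.
        assert (0 < g s).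
        { unfold g. apply Rdiv_lt_0_compat; nra. }
        replace (du s * v s - u s * dv s) with 0 by nra.
        specialize (Hv s Hs'). field. lra. }
      rewrite <- E. apply dQ. lra.
    - intros s Hs. rewrite Rmin_left, Rmax_right in Hs by lra.
      apply continuity_pt_filterlim, (ex_derive_continuous Q).
      eexists. apply dQ. lra. }
  assert (Q0 : Q 0 = 1).
  { unfold Q, u, v, y.
    replace (4 * 0 / (1 + 0) ^ 2) with 0 by field.
    replace (0 ^ 2) with 0 by ring.
    assert (0 < Kfun 0) by (apply Kfun_pos; lra). field. lra. }
  change (v r = u r).
  assert (E : u r = Q r * v r) by (unfold Q; specialize (Hv r Hr); field; lra).
  rewrite E, HQ, Q0. ring.
Qed.

End Landen.

(** * Integration over the positive half-line *)

Notation is_RInt_pos f l :=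
  (is_RInt_gen (V := R_NormedModule) f (at_right 0) (Rbar_locally p_infty) l).

Lemma pos_ends : forall P : R * R -> Prop,
  (forall u v, 0 < u < 1 -> 1 < v -> P (u, v)) ->
  filter_prod (at_right 0) (Rbar_locally p_infty) P.
Proof.
  intros P HP.
  apply (Filter_prod _ _ _ (fun u => 0 < u < 1) (fun v => 1 < v)).
  - exists (mkposreal 1 Rlt_0_1). intros u Hu Hu0. split; [exact Hu0|].
    unfold ball in Hu; simpl in Hu. unfold AbsRing_ball, abs, minus, plus, opp in Hu.
    simpl in Hu. apply Rabs_def2 in Hu. lra.
  - exists 1. auto.
  - exact HP.
Qed.

Lemma ex_RInt_pos : forall (f : R -> R) u v,
  (forall t, 0 < t -> continuous f t) -> 0 < u -> u <= v -> ex_RInt f u v.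
Proof.
  intros f u v Hf Hu Huv. apply (ex_RInt_continuous (V := R_CompleteNormedModule)).
  intros t Ht. rewrite Rmin_left, Rmax_right in Ht by lra. apply Hf. lra.
Qed.

Lemma RInt_pos_enlarge : forall (f : R -> R) u u' v v',
  (forall t, 0 < t -> continuous f t) -> (forall t, 0 < t -> 0 <= f t) ->
  0 < u' <= u -> u <= v -> v <= v' ->
  RInt f u v <= RInt f u' v'.
Proof.
  intros f u u' v v' Cf Pf Hu Huv Hv.
  assert (E1 : ex_RInt f u' u) by (apply ex_RInt_pos; auto; lra).
  assert (E2 : ex_RInt f u v) by (apply ex_RInt_pos; auto; lra).
  assert (E3 : ex_RInt f v v') by (apply ex_RInt_pos; auto; lra).
  assert (E4 : ex_RInt f u v') by (eapply ex_RInt_Chasles; eassumption).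
  rewrite <- (RInt_Chasles f u' u v') by assumption.
  rewrite <- (RInt_Chasles f u v v') by assumption.
  assert (0 <= RInt f u' u) by (apply RInt_ge_0; [lra|auto|intros; apply Pf; lra]).
  assert (0 <= RInt f v v') by (apply RInt_ge_0; [lra|auto|intros; apply Pf; lra]).
  unfold plus; simpl. lra.
Qed.

(** Monotone convergence for the improper integral: the integrals over compact
    intervals increase to their supremum. *)
Lemma ex_RInt_pos_bounded : forall (f : R -> R) M,
  (forall t, 0 < t -> continuous f t) -> (forall t, 0 < t -> 0 <= f t) ->
  (forall u v, 0 < u -> u <= v -> RInt f u v <= M) ->
  exists l, is_RInt_pos f l.
Proof.
  intros f M Cf Pf HM.
  set (E := fun z => exists u v, 0 < u /\ u <= v /\ z = RInt f u v).
  destruct (completeness E) as [l [Hub Hlub]].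
  { exists M. intros z (u & v & Hu & Huv & ->). apply HM; assumption. }
  { exists (RInt f 1 1), 1, 1. repeat split; lra. }
  exists l. intros P [eps Heps].
  assert (Hex : exists u v, 0 < u /\ u <= v /\ l - eps < RInt f u v).
  { apply Classical_Prop.NNPP. intro C.
    assert (l <= l - eps); [|pose proof (cond_pos eps); lra].
    apply Hlub. intros z (u & v & Hu & Huv & ->).
    apply Rnot_lt_le. intro D. apply C. exists u, v. auto. }
  destruct Hex as (u & v & Hu & Huv & Hl).
  apply (Filter_prod _ _ _ (fun t => 0 < t < u) (fun t => v < t)).
  - exists (mkposreal u Hu). intros t Ht Ht0. split; [exact Ht0|].
    unfold ball in Ht; simpl in Ht. unfold AbsRing_ball, abs, minus, plus, opp in Ht.
    simpl in Ht. apply Rabs_def2 in Ht. lra.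
  - exists v. auto.
  - intros u' v' Hu' Hv'. exists (RInt f u' v'). split.
    + apply (RInt_correct f), ex_RInt_pos; auto; simpl; lra.
    + apply Heps.
      assert (RInt f u v <= RInt f u' v') by (apply RInt_pos_enlarge; auto; lra).
      assert (RInt f u' v' <= l).
      { apply Hub. exists u', v'. repeat split; lra. }
      unfold ball; simpl. unfold AbsRing_ball, abs, minus, plus, opp; simpl.
      apply Rabs_def1; lra.
Qed.

Lemma is_RInt_pos_le : forall (f g : R -> R) lf lg,
  (forall t, 0 < t -> 0 <= f t <= g t) ->
  is_RInt_pos f lf -> is_RInt_pos g lg -> lf <= lg.
Proof.
  intros f g lf lg Hfg If Ig.
  apply Rle_trans with (Rabs lf); [apply Rle_abs|].
  apply (RInt_gen_norm (V := R_CompleteNormedModule) (Fa := at_right 0)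
           (Fb := Rbar_locally p_infty) f g lf lg).
  - apply pos_ends. simpl. intros. lra.
  - apply pos_ends. simpl. intros u v Hu Hv t Ht.
    assert (0 <= f t <= g t) by (apply Hfg; lra).
    unfold norm; simpl. unfold abs; simpl. rewrite Rabs_pos_eq; lra.
  - exact If.
  - exact Ig.
Qed.

Lemma is_RInt_pos_gt_0 : forall (f : R -> R) l,
  (forall t, 0 < t -> continuous f t) -> (forall t, 0 < t -> 0 < f t) ->
  is_RInt_pos f l -> 0 < l.
Proof.
  intros f l Cf Pf If.
  assert (H12 : 0 < RInt f 1 2).
  { apply RInt_gt_0; [lra | intros; apply Pf; lra | intros; apply Cf; lra]. }
  apply Rnot_le_lt. intro Hl.
  assert (HP : locally l (fun z => z < RInt f 1 2)) by (apply open_lt; lra).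
  specialize (If _ HP). destruct If as [Q S [d HQ] [M HS] H].
  assert (Q (Rmin (d / 2) 1)) as Hu.
  { pose proof (cond_pos d). apply HQ.
    - unfold ball; simpl. unfold AbsRing_ball, abs, minus, plus, opp; simpl.
      pose proof (Rmin_l (d / 2) 1). assert (0 < Rmin (d / 2) 1) by (apply Rmin_pos; lra).
      apply Rabs_def1; lra.
    - apply Rmin_pos; lra. }
  assert (S (Rmax (M + 1) 2)) as Hv.
  { apply HS. pose proof (Rmax_l (M + 1) 2). lra. }
  destruct (H _ _ Hu Hv) as (z & Hz & Hlt). simpl in Hz.
  apply (is_RInt_unique (V := R_CompleteNormedModule) f) in Hz.
  assert (RInt f 1 2 <= z); [|lra].
  rewrite <- Hz. pose proof (cond_pos d).
  pose proof (Rmin_r (d / 2) 1). pose proof (Rmax_r (M + 1) 2).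
  apply RInt_pos_enlarge; auto; try lra.
  - intros; apply Rlt_le; auto.
  - split; [apply Rmin_pos; lra | lra].
Qed.

Lemma is_RInt_pos_ext : forall (f g : R -> R) l,
  (forall t, 0 < t -> f t = g t) -> is_RInt_pos f l -> is_RInt_pos g l.
Proof.
  intros f g l Hfg. apply is_RInt_gen_ext. apply pos_ends. simpl.
  intros u v Hu Hv t Ht. rewrite Rmin_left, Rmax_right in Ht by lra. apply Hfg. lra.
Qed.

Lemma is_RInt_pos_derive : forall (F f : R -> R) la lb,
  (forall t, 0 < t -> is_derive F t (f t)) ->
  (forall t, 0 < t -> continuous f t) ->
  filterlim F (at_right 0) (locally la) ->
  filterlim F (Rbar_locally p_infty) (locally lb) ->
  is_RInt_pos f (lb - la).
Proof.
  intros F f la lb HF Cf La Lb.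
  assert (HD : forall t, 0 < t -> Derive F t = f t)
    by (intros; apply is_derive_unique; auto).
  apply is_RInt_pos_ext with (Derive F); [exact HD|].
  apply is_RInt_gen_Derive; try assumption.
  - apply pos_ends. simpl. intros u v Hu Hv t Ht.
    rewrite Rmin_left in Ht by lra. exists (f t). apply HF. lra.
  - apply pos_ends. simpl. intros u v Hu Hv t Ht. rewrite Rmin_left in Ht by lra.
    assert (Ht0 : 0 < t) by lra.
    apply continuous_ext_loc with f; [|apply Cf, Ht0].
    assert (HP : locally t (fun s => 0 < s)) by (apply open_gt; exact Ht0).
    revert HP. apply filter_imp. intros s Hs. symmetry. apply HD, Hs.
Qed.

(** * The Gamma function *)

Definition gamma_density (s t : R) : R := Rpower t (s - 1) * exp (- t).

Lemma gamma_density_pos : forall s t, 0 < gamma_density s t.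
Proof. intros. apply Rmult_lt_0_compat; apply exp_pos. Qed.

Lemma is_derive_Rpower : forall s t, 0 < t ->
  is_derive (fun t => Rpower t s) t (s * Rpower t (s - 1)).
Proof. intros s t Ht. apply is_derive_Reals, derivable_pt_lim_power, Ht. Qed.

Lemma is_derive_exp_neg : forall t, is_derive (fun t => exp (- t)) t (- exp (- t)).
Proof. intro t. auto_derive; [trivial | ring]. Qed.

Lemma continuous_gamma_density : forall s t, 0 < t -> continuous (gamma_density s) t.
Proof.
  intros s t Ht. apply (ex_derive_continuous (gamma_density s)).
  eexists. apply (is_derive_mult (fun t => Rpower t (s - 1)) (fun t => exp (- t))).
  - apply is_derive_Rpower, Ht.
  - apply is_derive_exp_neg.
  - intros; apply Rmult_comm.
Qed.

Lemma Rpower_succ : forall t s, 0 < t -> Rpower t (s + 1) = Rpower t s * t.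
Proof. intros. rewrite Rpower_plus, Rpower_1 by assumption. reflexivity. Qed.

Lemma gamma_density_succ : forall s t, 0 < t ->
  gamma_density (s + 1) t = t * gamma_density s t.
Proof.
  intros s t Ht. unfold gamma_density.
  replace (s + 1 - 1) with (s - 1 + 1) by ring. rewrite Rpower_succ by exact Ht. ring.
Qed.

Lemma gamma_boundary_0 : forall s, 0 < s ->
  filterlim (fun t => Rpower t s * exp (- t)) (at_right 0) (locally 0).
Proof.
  intros s Hs.
  apply (filterlim_le_le (fun _ => 0) _ (fun t => Rpower t s) 0).
  - exists (mkposreal 1 Rlt_0_1). intros t _ Ht.
    assert (0 < Rpower t s) by apply exp_pos.
    assert (0 < exp (- t)) by apply exp_pos.
    assert (exp (- t) <= 1) by (rewrite <- exp_0; left; apply exp_increasing; lra).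
    split; nra.
  - apply filterlim_const.
  - unfold Rpower. eapply filterlim_comp; [|apply is_lim_exp_m].
    apply (filterlim_comp _ _ _ ln (fun z => s * z) _ (Rbar_locally m_infty));
      [apply is_lim_ln_0|].
    intros P [M HM]. exists (M / s). intros z Hz. apply HM.
    apply Rmult_lt_reg_r with (/ s); [apply Rinv_0_lt_compat, Hs|].
    replace (s * z * / s) with z by (field; lra). exact Hz.
Qed.

Lemma gamma_boundary_infty : forall s,
  filterlim (fun t => Rpower t s * exp (- t)) (Rbar_locally p_infty) (locally 0).
Proof.
  intros s.
  apply (filterlim_ext_loc (fun t => exp (t * (s * (ln t / t) - 1)))).
  - exists 0. intros t Ht. unfold Rpower. rewrite <- exp_plus. f_equal. field. lra.
  - eapply filterlim_comp; [|apply is_lim_exp_m].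
    change (is_lim (fun t => t * (s * (ln t / t) - 1)) p_infty m_infty).
    replace m_infty with (Rbar_mult p_infty (s * 0 - 1)).
    2:{ replace (s * 0 - 1) with (- (1)) by ring. simpl.
        destruct (Rle_dec 0 (- (1))) as [C|_]; [exfalso; lra|reflexivity]. }
    apply is_lim_mult.
    + apply is_lim_id.
    + apply (is_lim_minus _ _ _ (s * 0) 1).
      * apply (is_lim_scal_l _ s p_infty 0). apply is_lim_div_ln_p.
      * apply is_lim_const.
      * reflexivity.
    + simpl. lra.
Qed.

(** The integrand is the derivative of [t^s e^-t], whose boundary values vanish.
    Integrability at [s] and at [s+1] thus imply each other, which extends the
    convergence of the integral from [1 <= s <= 2] to all [s > 0]. *)
Lemma gamma_by_parts : forall s, 0 < s ->
  is_RInt_pos (fun t => s * gamma_density s t - gamma_density (s + 1) t) 0.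
Proof.
  intros s Hs. rewrite <- (Rminus_0_r 0) at 2.
  apply is_RInt_pos_derive with (fun t => Rpower t s * exp (- t)).
  - intros t Ht.
    replace (s * gamma_density s t - gamma_density (s + 1) t) with
      (s * Rpower t (s - 1) * exp (- t) + Rpower t s * (- exp (- t))).
    + apply (is_derive_mult (fun t => Rpower t s) (fun t => exp (- t))).
      * apply is_derive_Rpower, Ht.
      * apply is_derive_exp_neg.
      * intros; apply Rmult_comm.
    + unfold gamma_density. replace (s + 1 - 1) with s by ring. ring.
  - intros t Ht.
    apply (continuous_minus (V := R_NormedModule) (fun t => s * gamma_density s t)).
    + apply (continuous_scal_r (V := R_NormedModule) s (gamma_density s)).
      apply continuous_gamma_density, Ht.
    + apply continuous_gamma_density, Ht.
  - apply gamma_boundary_0, Hs.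
  - apply gamma_boundary_infty.
Qed.

Lemma gamma_integral_up : forall s l, 0 < s ->
  is_RInt_pos (gamma_density s) l -> is_RInt_pos (gamma_density (s + 1)) (s * l).
Proof.
  intros s l Hs H.
  replace (s * l) with (minus (scal s l) 0)
    by (unfold minus, plus, opp, scal; simpl; unfold mult; simpl; ring).
  apply is_RInt_pos_ext with
    (fun t => minus (scal s (gamma_density s t))
                    (s * gamma_density s t - gamma_density (s + 1) t)).
  - intros. unfold minus, plus, opp, scal; simpl; unfold mult; simpl. ring.
  - apply (is_RInt_gen_minus (V := R_NormedModule)).
    + apply (is_RInt_gen_scal (V := R_NormedModule)), H.
    + apply gamma_by_parts, Hs.
Qed.

Lemma gamma_integral_down : forall s l, 0 < s ->
  is_RInt_pos (gamma_density (s + 1)) l -> is_RInt_pos (gamma_density s) (l / s).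
Proof.
  intros s l Hs H.
  replace (l / s) with (scal (/ s) (plus l 0))
    by (unfold plus, scal; simpl; unfold mult; simpl; field; lra).
  apply is_RInt_pos_ext with
    (fun t => scal (/ s) (plus (gamma_density (s + 1) t)
                    (s * gamma_density s t - gamma_density (s + 1) t))).
  - intros. unfold plus, scal; simpl; unfold mult; simpl. field. lra.
  - apply (is_RInt_gen_scal (V := R_NormedModule)),
      (is_RInt_gen_plus (V := R_NormedModule)); [exact H|].
    apply gamma_by_parts, Hs.
Qed.

(** The chord between the exponents [0] and [1]: weighted AM-GM for [1] and [u],
    obtained from the tangent of [exp] at [a ln u]. *)
Lemma Rpower_Bernoulli : forall a u, 0 <= a <= 1 -> 0 < u ->
  Rpower u a <= 1 - a + a * u.
Proof.
  intros a u Ha Hu. unfold Rpower. set (m := a * ln u).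
  pose proof (exp_ineq1_le (ln u - m)) as H1.
  pose proof (exp_ineq1_le (- m)) as H2.
  pose proof (exp_pos m) as Hm.
  assert (E1 : exp (ln u - m) * exp m = u).
  { rewrite <- exp_plus. replace (ln u - m + m) with (ln u) by ring. apply exp_ln, Hu. }
  assert (E2 : exp (- m) * exp m = 1).
  { rewrite <- exp_plus. replace (- m + m) with 0 by ring. apply exp_0. }
  assert (H : 1 <= a * exp (ln u - m) + (1 - a) * exp (- m)).
  { apply Rle_trans with (a * (1 + (ln u - m)) + (1 - a) * (1 + - m)).
    - unfold m. lra.
    - apply Rplus_le_compat; apply Rmult_le_compat_l; lra. }
  apply Rle_trans with ((a * exp (ln u - m) + (1 - a) * exp (- m)) * exp m).
  - nra.
  - rewrite Rmult_plus_distr_r, !Rmult_assoc, E1, E2. lra.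
Qed.

Lemma ex_gamma_integral_base : forall s, 1 <= s <= 2 ->
  exists l, is_RInt_pos (gamma_density s) l.
Proof.
  intros s Hs.
  apply ex_RInt_pos_bounded with 2.
  - intros; apply continuous_gamma_density; assumption.
  - intros; apply Rlt_le, gamma_density_pos.
  - intros u v Hu Huv.
    (* on this range t^(s-1) <= 1 + t, and (1+t) e^-t has primitive -(2+t) e^-t *)
    assert (I : is_RInt (fun t => (1 + t) * exp (- t)) u v
                  (minus (- ((2 + v) * exp (- v))) (- ((2 + u) * exp (- u))))).
    { apply (is_RInt_derive (fun t => - ((2 + t) * exp (- t)))
               (fun t => (1 + t) * exp (- t))).
      - intros t _. auto_derive; [trivial | ring].
      - intros t _. apply (ex_derive_continuous (fun t => (1 + t) * exp (- t))).
        auto_derive. trivial. }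
    apply Rle_trans with (RInt (fun t => (1 + t) * exp (- t)) u v).
    + apply RInt_le; [exact Huv | | eexists; exact I |].
      * apply ex_RInt_pos; [|exact Hu|exact Huv].
        intros; apply continuous_gamma_density; assumption.
      * intros t Ht. apply Rmult_le_compat_r; [apply Rlt_le, exp_pos|].
        apply Rle_trans with (1 - (s - 1) + (s - 1) * t);
          [apply Rpower_Bernoulli; lra | nra].
    + rewrite (is_RInt_unique _ _ _ _ I). unfold minus, plus, opp; simpl.
      assert (0 < exp (- v)) by apply exp_pos.
      assert ((2 + u) * exp (- u) <= 2).
      { pose proof (exp_ineq1_le u). pose proof (exp_pos (- u)).
        assert (exp (- u) * exp u = 1).
        { rewrite <- exp_plus. replace (- u + u) with 0 by ring. apply exp_0. }
        nra. }
      nra.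
Qed.

Lemma ex_gamma_integral : forall s, 0 < s ->
  exists l, is_RInt_pos (gamma_density s) l.
Proof.
  assert (H : forall n s, 0 < s <= INR n + 2 ->
            exists l, is_RInt_pos (gamma_density s) l).
  { induction n as [|n IH]; intros s Hs.
    - simpl in Hs. destruct (Rle_dec 1 s) as [H1|H1].
      + apply ex_gamma_integral_base. lra.
      + destruct (ex_gamma_integral_base (s + 1)) as [l Hl]; [lra|].
        exists (l / s). apply gamma_integral_down; [lra | exact Hl].
    - rewrite S_INR in Hs. destruct (Rle_dec s (INR n + 2)) as [H1|H1].
      + apply IH. lra.
      + pose proof (pos_INR n). destruct (IH (s - 1)) as [l Hl]; [lra|].
        exists ((s - 1) * l). replace s with (s - 1 + 1) at 1 by ring.
        apply gamma_integral_up; [lra | exact Hl]. }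
  intros s Hs. destruct (nfloor_ex s) as [n Hn]; [lra|].
  apply (H n). lra.
Qed.

Lemma is_RInt_Gamma : forall s, 0 < s -> is_RInt_pos (gamma_density s) (Gamma s).
Proof.
  intros s Hs. apply (RInt_gen_correct (V := R_CompleteNormedModule)).
  destruct (ex_gamma_integral s Hs) as [l Hl]. exists l. exact Hl.
Qed.

Lemma Gamma_unique : forall s l, is_RInt_pos (gamma_density s) l -> Gamma s = l.
Proof.
  intros s l H.
  exact (is_RInt_gen_unique (V := R_CompleteNormedModule) (gamma_density s) l H).
Qed.

Lemma Gamma_pos : forall s, 0 < s -> 0 < Gamma s.
Proof.
  intros s Hs. apply is_RInt_pos_gt_0 with (gamma_density s).
  - intros; apply continuous_gamma_density; assumption.
  - intros; apply gamma_density_pos.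
  - apply is_RInt_Gamma, Hs.
Qed.

Lemma Gamma_succ : forall s, 0 < s -> Gamma (s + 1) = s * Gamma s.
Proof.
  intros s Hs. apply Gamma_unique, gamma_integral_up; [exact Hs|].
  apply is_RInt_Gamma, Hs.
Qed.

Lemma Gamma_1 : Gamma 1 = 1.
Proof.
  apply Gamma_unique. replace 1 with (0 - (- (1))) at 2 by ring.
  apply is_RInt_pos_derive with (fun t => - exp (- t)).
  - intros t Ht. unfold gamma_density. replace (1 - 1) with 0 by ring.
    rewrite Rpower_O by exact Ht. auto_derive; [trivial | ring].
  - intros; apply continuous_gamma_density; assumption.
  - assert (C : continuous (fun t => - exp (- t)) 0).
    { apply (ex_derive_continuous (fun t => - exp (- t))). auto_derive. trivial. }
    assert (E : - (1) = - exp (- 0)) by (rewrite Ropp_0, exp_0; reflexivity).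
    rewrite E. eapply filterlim_filter_le_1; [|exact C].
    apply filter_le_within.
  - assert (L := gamma_boundary_infty 0).
    apply (filterlim_ext_loc (fun t => - (Rpower t 0 * exp (- t)))).
    + exists 0. intros t Ht. rewrite Rpower_O by exact Ht. ring.
    + eapply filterlim_comp; [exact L|].
      rewrite <- Ropp_0 at 2. apply (filterlim_opp (V := R_NormedModule) 0).
Qed.

Lemma Gamma_poch : forall a n, 0 < a -> Gamma (a + INR n) = poch a n * Gamma a.
Proof.
  intros a n Ha. induction n as [|n IH].
  - simpl. rewrite Rplus_0_r. ring.
  - pose proof (pos_INR n). rewrite S_INR.
    replace (a + (INR n + 1)) with (a + INR n + 1) by ring.
    rewrite Gamma_succ by lra. rewrite IH. simpl. ring.
Qed.

Lemma Gamma_INR_S : forall n, Gamma (INR n + 1) = INR (fact n).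
Proof.
  induction n as [|n IH].
  - simpl. rewrite Rplus_0_l. apply Gamma_1.
  - pose proof (pos_INR n). rewrite S_INR, Gamma_succ by lra.
    rewrite IH, fact_simpl, mult_INR, S_INR. ring.
Qed.

(** Integrate the chord bound for the power [a] at [t/x]; the two resulting terms
    recombine by [Gamma (x+1) = x Gamma x]. *)
Lemma Gamma_shift_le : forall a x, 0 <= a <= 1 -> 0 < x ->
  Gamma (x + a) <= Rpower x a * Gamma x.
Proof.
  intros a x Ha Hx.
  assert (Hp : 0 < Rpower x a) by apply exp_pos.
  replace (Rpower x a * Gamma x)
    with (plus (scal (Rpower x a * (1 - a)) (Gamma x))
               (scal (Rpower x a * a / x) (Gamma (x + 1)))).
  2:{ rewrite Gamma_succ by exact Hx.
      unfold plus, scal; simpl; unfold mult; simpl. field. lra. }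
  apply is_RInt_pos_le with (gamma_density (x + a))
    (fun t => plus (scal (Rpower x a * (1 - a)) (gamma_density x t))
                   (scal (Rpower x a * a / x) (gamma_density (x + 1) t))).
  - intros t Ht. split; [apply Rlt_le, gamma_density_pos|].
    rewrite gamma_density_succ by exact Ht.
    replace (gamma_density (x + a) t)
      with (Rpower x a * Rpower (t / x) a * gamma_density x t).
    2:{ unfold gamma_density.
        replace (x + a - 1) with (a + (x - 1)) by ring.
        rewrite Rpower_plus, Rpower_mult_distr by (try apply Rdiv_lt_0_compat; lra).
        replace (x * (t / x)) with t by (field; lra). ring. }
    unfold plus, scal; simpl; unfold mult; simpl.
    replace (Rpower x a * (1 - a) * gamma_density x t
             + Rpower x a * a / x * (t * gamma_density x t))
      with (Rpower x a * (1 - a + a * (t / x)) * gamma_density x t) by (field; lra).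
    apply Rmult_le_compat_r; [apply Rlt_le, gamma_density_pos|].
    apply Rmult_le_compat_l; [lra|].
    apply Rpower_Bernoulli; [exact Ha | apply Rdiv_lt_0_compat; lra].
  - apply is_RInt_Gamma. lra.
  - apply (is_RInt_gen_plus (V := R_NormedModule));
      apply (is_RInt_gen_scal (V := R_NormedModule)); apply is_RInt_Gamma; lra.
Qed.

Definition Gamma_shift_ratio (a x : R) : R := Gamma (x + a) / (Rpower x a * Gamma x).

Lemma Gamma_shift_ratio_bounds : forall a x, 0 <= a <= 1 -> 0 < x ->
  x / (x + a) <= Gamma_shift_ratio a x <= 1.
Proof.
  intros a x Ha Hx. unfold Gamma_shift_ratio.
  assert (Hp : 0 < Rpower x a) by apply exp_pos.
  assert (HG : 0 < Gamma x) by (apply Gamma_pos, Hx).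
  assert (HGa : 0 < Gamma (x + a)) by (apply Gamma_pos; lra).
  assert (HpG : 0 < Rpower x a * Gamma x) by nra.
  split.
  - (* the upper bound, applied to the shift from x + a to x + 1 *)
    assert (H := Gamma_shift_le (1 - a) (x + a)).
    replace (x + a + (1 - a)) with (x + 1) in H by ring.
    rewrite Gamma_succ in H by exact Hx.
    specialize (H ltac:(lra) ltac:(lra)).
    assert (Hq : 0 < Rpower (x + a) a) by apply exp_pos.
    assert (E : Rpower (x + a) (1 - a) * Rpower (x + a) a = x + a).
    { rewrite <- Rpower_plus. replace (1 - a + a) with 1 by ring. apply Rpower_1. lra. }
    assert (M : Rpower x a <= Rpower (x + a) a).
    { apply Rle_Rpower_l; lra. }
    assert (x * Gamma x * Rpower x a <= (x + a) * Gamma (x + a)).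
    { apply Rle_trans with (x * Gamma x * Rpower (x + a) a).
      - apply Rmult_le_compat_l; nra.
      - replace ((x + a) * Gamma (x + a))
          with (Rpower (x + a) (1 - a) * Gamma (x + a) * Rpower (x + a) a).
        + apply Rmult_le_compat_r; lra.
        + transitivity (Rpower (x + a) (1 - a) * Rpower (x + a) a * Gamma (x + a));
            [ring | rewrite E; reflexivity]. }
    apply Rmult_le_reg_r with ((x + a) * (Rpower x a * Gamma x)); [nra|].
    replace (x / (x + a) * ((x + a) * (Rpower x a * Gamma x)))
      with (x * Gamma x * Rpower x a) by (field; lra).
    replace (Gamma (x + a) / (Rpower x a * Gamma x) * ((x + a) * (Rpower x a * Gamma x)))
      with ((x + a) * Gamma (x + a)) by (field; lra).
    assumption.
  - apply Rmult_le_reg_r with (Rpower x a * Gamma x); [exact HpG|].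
    unfold Rdiv. rewrite Rmult_assoc, Rinv_l by lra.
    rewrite Rmult_1_r, Rmult_1_l. apply Gamma_shift_le; assumption.
Qed.

Lemma Gamma_shift_ratio_succ : forall a x, 0 <= a -> 0 < x ->
  Gamma_shift_ratio (a + 1) x = Gamma_shift_ratio a x * (1 + a / x).
Proof.
  intros a x Ha Hx. unfold Gamma_shift_ratio.
  replace (x + (a + 1)) with (x + a + 1) by ring.
  rewrite Gamma_succ, Rpower_succ by lra.
  assert (0 < Rpower x a) by apply exp_pos.
  assert (0 < Gamma x) by (apply Gamma_pos, Hx).
  field. repeat split; lra.
Qed.

(** [Gamma (x+a) ~ x^a Gamma x] along the integers: by squeezing for
    [0 <= a <= 1], and then by the functional equation. *)
Lemma is_lim_Gamma_shift_ratio : forall a, 0 <= a ->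
  is_lim_seq (fun n => Gamma_shift_ratio a (INR n + 1)) 1.
Proof.
  assert (Hinv : forall c, is_lim_seq (fun n => c / (INR n + 1)) 0).
  { intro c. replace (Finite 0) with (Rbar_mult c 0) by (simpl; f_equal; ring).
    apply (is_lim_seq_scal_l (fun n => / (INR n + 1))), is_lim_seq_inv_INR_S. }
  assert (H : forall k a, 0 <= a <= INR k + 1 ->
            is_lim_seq (fun n => Gamma_shift_ratio a (INR n + 1)) 1).
  { induction k as [|k IH]; intros a Ha.
    - simpl in Ha.
      apply is_lim_seq_le_le with (fun n => 1 - a / (INR n + 1)) (fun _ => 1).
      + intro n. pose proof (pos_INR n).
        destruct (Gamma_shift_ratio_bounds a (INR n + 1)) as [L U]; [lra|lra|].
        split; [|exact U]. eapply Rle_trans; [|exact L].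
        replace ((INR n + 1) / (INR n + 1 + a)) with (1 - a / (INR n + 1 + a))
          by (field; lra).
        assert (a / (INR n + 1 + a) <= a / (INR n + 1)); [|lra].
        apply Rmult_le_compat_l; [lra|]. apply Rinv_le_contravar; lra.
      + replace (Finite 1) with (Finite (1 - 0)) by (f_equal; ring).
        apply is_lim_seq_minus'; [apply is_lim_seq_const | apply Hinv].
      + apply is_lim_seq_const.
    - rewrite S_INR in Ha. destruct (Rle_dec a (INR k + 1)) as [Hk|Hk].
      + apply IH. lra.
      + pose proof (pos_INR k).
        apply is_lim_seq_ext with
          (fun n => Gamma_shift_ratio (a - 1) (INR n + 1) * (1 + (a - 1) / (INR n + 1))).
        * intro n. pose proof (pos_INR n).
          replace a with (a - 1 + 1) at 3 by ring.
          rewrite Gamma_shift_ratio_succ by lra. reflexivity.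
        * replace (Finite 1) with (Finite (1 * (1 + 0))) by (f_equal; ring).
          apply is_lim_seq_mult'; [apply IH; lra|].
          apply is_lim_seq_plus'; [apply is_lim_seq_const | apply Hinv]. }
  intros a Ha. destruct (nfloor_ex a Ha) as [k Hk]. apply (H k). lra.
Qed.

Lemma Beta_pos : forall a b, 0 < a -> 0 < b -> 0 < Beta a b.
Proof.
  intros a b Ha Hb. unfold Beta.
  assert (0 < Gamma a) by (apply Gamma_pos; lra).
  assert (0 < Gamma b) by (apply Gamma_pos; lra).
  assert (0 < Gamma (a + b)) by (apply Gamma_pos; lra).
  apply Rdiv_lt_0_compat; nra.
Qed.

(** Writing every Pochhammer symbol as a quotient of Gamma values,
    [n c_n = (1/B(a,b)) rho_a rho_b / rho_(a+b)] with [rho] the ratio above: the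
    powers of [n] cancel exactly because the series is zero-balanced. *)
Lemma is_lim_coef : forall a b, 0 < a -> 0 < b ->
  is_lim_seq (fun n => (INR n + 1) * coef a b (S n)) (/ Beta a b).
Proof.
  intros a b Ha Hb.
  apply is_lim_seq_ext with (fun n =>
    / Beta a b * (Gamma_shift_ratio a (INR n + 1) * Gamma_shift_ratio b (INR n + 1)
                  / Gamma_shift_ratio (a + b) (INR n + 1))).
  - intro n. pose proof (pos_INR n).
    assert (HG : forall c, 0 < c -> Gamma_shift_ratio c (INR n + 1)
              = poch c (S n) * Gamma c / (Rpower (INR n + 1) c * INR (fact n))).
    { intros c Hc. unfold Gamma_shift_ratio. rewrite Gamma_INR_S, <- Gamma_poch by exact Hc.
      do 2 f_equal. rewrite S_INR. ring. }
    rewrite !HG by lra. rewrite Rpower_plus. unfold coef, Beta.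
    rewrite fact_simpl, mult_INR, S_INR.
    assert (0 < Gamma a) by (apply Gamma_pos; lra).
    assert (0 < Gamma b) by (apply Gamma_pos; lra).
    assert (0 < Gamma (a + b)) by (apply Gamma_pos; lra).
    assert (0 < poch (a + b) (S n)) by (apply poch_pos; lra).
    assert (0 < Rpower (INR n + 1) a) by apply exp_pos.
    assert (0 < Rpower (INR n + 1) b) by apply exp_pos.
    pose proof (INR_fact_lt_0 n).
    generalize dependent (poch (a + b) (S n)). intros.
    field. repeat split; lra.
  - replace (Finite (/ Beta a b)) with (Finite (/ Beta a b * (1 * 1 / 1)))
      by (f_equal; field; pose proof (Beta_pos a b Ha Hb); lra).
    apply is_lim_seq_mult'; [apply is_lim_seq_const|].
    apply is_lim_seq_div'; [|apply is_lim_Gamma_shift_ratio; lra|lra].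
    apply is_lim_seq_mult'; apply is_lim_Gamma_shift_ratio; lra.
Qed.

(** * Wallis's product *)

Definition wallis (n : nat) : R := RInt (fun x => sin x ^ n) 0 PI.

Lemma ex_RInt_sin_pow : forall n, ex_RInt (fun x => sin x ^ n) 0 PI.
Proof.
  intro n. apply (ex_RInt_continuous (V := R_CompleteNormedModule)).
  intros x _. apply (ex_derive_continuous (fun x => sin x ^ n)).
  auto_derive. trivial.
Qed.

Lemma wallis_0 : wallis 0 = PI.
Proof.
  unfold wallis. simpl. rewrite RInt_const. unfold scal; simpl; unfold mult; simpl. ring.
Qed.

Lemma wallis_1 : wallis 1 = 2.
Proof.
  apply is_RInt_unique. replace 2 with (minus (- cos PI) (- cos 0)).
  2:{ rewrite cos_PI, cos_0. unfold minus, plus, opp; simpl. ring. }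
  apply (is_RInt_derive (fun x => - cos x) (fun x => sin x ^ 1)).
  - intros x _. auto_derive; [trivial | ring].
  - intros x _. apply (ex_derive_continuous (fun x => sin x ^ 1)). auto_derive. trivial.
Qed.

(** [- cos x sin^(n+1) x] vanishes at both ends; its derivative is
    [(n+2) sin^(n+2) - (n+1) sin^n]. *)
Lemma wallis_SS : forall n, (INR n + 2) * wallis (S (S n)) = (INR n + 1) * wallis n.
Proof.
  intro n.
  assert (H : is_RInt (fun x => (INR n + 2) * sin x ^ S (S n) - (INR n + 1) * sin x ^ n)
                0 PI 0).
  { replace 0 with (minus (- cos PI * sin PI ^ S n) (- cos 0 * sin 0 ^ S n)) at 2.
    2:{ rewrite sin_PI, sin_0. unfold minus, plus, opp; simpl. ring. }
    apply (is_RInt_derive (fun x => - cos x * sin x ^ S n)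
      (fun x => (INR n + 2) * sin x ^ S (S n) - (INR n + 1) * sin x ^ n)).
    - intros x _. auto_derive; [trivial|].
      change (match n with 0%nat => 1 | S _ => INR n + 1 end) with (INR (S n)).
      rewrite S_INR. simpl.
      pose proof (sin2_cos2 x) as E. unfold Rsqr in E.
      replace (sin x * (sin x * sin x ^ n)) with ((sin x * sin x) * sin x ^ n) by ring.
      replace (- cos x * (1 * cos x * ((INR n + 1) * sin x ^ n)))
        with (- (INR n + 1) * (cos x * cos x) * sin x ^ n) by ring.
            replace (cos x * cos x) with (1 - sin x * sin x) by lra. ring.
    - intros x _. apply (ex_derive_continuous
        (fun x => (INR n + 2) * sin x ^ S (S n) - (INR n + 1) * sin x ^ n)).
      auto_derive. auto. }
  apply (is_RInt_unique (V := R_CompleteNormedModule)) in H.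
  rewrite (RInt_minus (V := R_CompleteNormedModule)
    (fun x => scal (INR n + 2) (sin x ^ S (S n))) (fun x => scal (INR n + 1) (sin x ^ n))) in H
    by (apply (ex_RInt_scal (V := R_NormedModule)), ex_RInt_sin_pow).
  rewrite !(RInt_scal (V := R_CompleteNormedModule)) in H by apply ex_RInt_sin_pow.
  unfold minus, plus, opp, scal in H; simpl in H; unfold mult in H; simpl in H.
  unfold wallis. simpl. lra.
Qed.

Lemma wallis_decreasing : forall n, wallis (S n) <= wallis n.
Proof.
  intro n. apply RInt_le; try apply ex_RInt_sin_pow; [left; apply PI_RGT_0|].
  intros x Hx. assert (0 <= sin x) by (apply sin_ge_0; lra).
  pose proof (SIN_bound x). pose proof (pow_le (sin x) n ltac:(assumption)).
  simpl. nra.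
Qed.

Lemma wallis_nonneg : forall n, 0 <= wallis n.
Proof.
  intro n. apply RInt_ge_0; [left; apply PI_RGT_0 | apply ex_RInt_sin_pow|].
  intros x Hx. apply pow_le, sin_ge_0; lra.
Qed.

Lemma wallis_consecutive : forall n, (INR n + 1) * (wallis n * wallis (S n)) = 2 * PI.
Proof.
  induction n as [|n IH].
  - rewrite wallis_0, wallis_1. simpl. ring.
  - rewrite <- IH, S_INR. pose proof (wallis_SS n) as E.
    replace ((INR n + 1 + 1) * (wallis (S n) * wallis (S (S n))))
      with (wallis (S n) * ((INR n + 2) * wallis (S (S n)))) by ring.
    rewrite E. ring.
Qed.

(** Both sides obey the same two-term recursion, since [d_(n+1)/d_n] is the
    square of [(2n+1)/(2n+2)]. *)
Lemma wallis_even : forall n, (wallis (2 * n) / PI) ^ 2 = dcoef n.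
Proof.
  intro n. pose proof PI_RGT_0. induction n as [|n IH].
  - rewrite coef_0. simpl (2 * 0)%nat. rewrite wallis_0. field. lra.
  - rewrite coef_S, <- IH by lra.
    replace (2 * S n)%nat with (S (S (2 * n))) by lia.
    pose proof (wallis_SS (2 * n)) as E. rewrite mult_INR in E. simpl (INR 2) in E.
    pose proof (pos_INR n).
    replace (wallis (S (S (2 * n)))) with
      ((2 * INR n + 1) * wallis (2 * n) / (2 * INR n + 2)).
    + field. repeat split; lra.
    + apply Rmult_eq_reg_l with (2 * INR n + 2); [|lra].
      replace ((2 * INR n + 2) * ((2 * INR n + 1) * wallis (2 * n) / (2 * INR n + 2)))
        with ((2 * INR n + 1) * wallis (2 * n)) by (field; lra).
      lra.
Qed.

(** As [wallis] decreases, [wallis n ^ 2] is squeezed between two consecutive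
    products, whose values are [wallis_consecutive]. *)
Lemma is_lim_dcoef : is_lim_seq (fun n => (INR n + 1) * dcoef (S n)) (/ PI).
Proof.
  pose proof PI_RGT_0 as Hpi.
  apply is_lim_seq_le_le with
    (fun n => / PI * (1 - / (INR n + 1))) (fun _ => / PI).
  - intro n. pose proof (pos_INR n).
    rewrite <- wallis_even.
    pose proof (wallis_consecutive (2 * S n)) as L.
    pose proof (wallis_consecutive (S (2 * n))) as U.
    replace (S (S (2 * n))) with (2 * S n)%nat in U by lia.
    pose proof (wallis_decreasing (2 * S n)).
    pose proof (wallis_decreasing (S (2 * n))) as D.
    replace (S (S (2 * n))) with (2 * S n)%nat in D by lia.
    pose proof (wallis_nonneg (2 * S n)).
    rewrite (S_INR (2 * n)), mult_INR in U. rewrite mult_INR, (S_INR n) in L. simpl (INR 2) in *.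
    set (w := wallis (2 * S n)) in *.
    assert (L2 : 2 * PI <= (2 * (INR n + 1) + 1) * w ^ 2).
    { rewrite <- L. replace (1 + 1) with 2 by ring. apply Rmult_le_compat_l; [lra|]. nra. }
    assert (U2 : (INR n + 1) * w ^ 2 <= PI).
    { assert (w * w <= wallis (S (2 * n)) * w) by nra. nra. }
    assert (0 < PI ^ 2) by nra.
    replace ((INR n + 1) * (w / PI) ^ 2) with (((INR n + 1) * w ^ 2) / PI ^ 2) by (field; lra).
    split.
    + apply Rmult_le_reg_r with (PI ^ 2); [lra|].
      replace ((INR n + 1) * w ^ 2 / PI ^ 2 * PI ^ 2) with ((INR n + 1) * w ^ 2)
        by (field; lra).
      replace (/ PI * (1 - / (INR n + 1)) * PI ^ 2)
        with (PI * (INR n / (INR n + 1))) by (field; lra).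
      apply Rmult_le_reg_r with (INR n + 1); [lra|].
      replace (PI * (INR n / (INR n + 1)) * (INR n + 1)) with (PI * INR n) by (field; lra).
      nra.
    + apply Rmult_le_reg_r with (PI ^ 2); [lra|].
      replace ((INR n + 1) * w ^ 2 / PI ^ 2 * PI ^ 2) with ((INR n + 1) * w ^ 2)
        by (field; lra).
      replace (/ PI * PI ^ 2) with PI by (field; lra). exact U2.
  - replace (Finite (/ PI)) with (Finite (/ PI * (1 - 0))) by (f_equal; ring).
    apply is_lim_seq_mult'; [apply is_lim_seq_const|].
    apply is_lim_seq_minus'; [apply is_lim_seq_const | apply is_lim_seq_inv_INR_S].
  - apply is_lim_seq_const.
Qed.

(** * The comparison of [k] with the elliptic integral *)

Lemma is_lim_coef_quotient : forall a b, 0 < a -> 0 < b ->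
  is_lim_seq (fun n => coef a b n / dcoef n) (PI / Beta a b).
Proof.
  intros a b Ha Hb. pose proof PI_RGT_0 as Hpi. pose proof (Beta_pos a b Ha Hb).
  apply is_lim_seq_incr_1.
  apply is_lim_seq_ext with
    (fun n => (INR n + 1) * coef a b (S n) / ((INR n + 1) * dcoef (S n))).
  - intro n. pose proof (pos_INR n).
    assert (0 < dcoef (S n)) by (apply coef_pos; lra). field. lra.
  - replace (Finite (PI / Beta a b)) with (Finite (/ Beta a b / / PI))
      by (f_equal; field; lra).
    apply is_lim_seq_div'; [apply is_lim_coef; assumption | apply is_lim_dcoef |].
    pose proof (Rinv_0_lt_compat PI Hpi). lra.
Qed.

Lemma coef_bounds_of_quotient : forall a b n l h, 0 < a -> 0 < b ->
  l <= coef a b n / dcoef n <= h ->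
  l * dcoef n <= coef a b n <= h * dcoef n.
Proof.
  intros a b n l h Ha Hb H.
  assert (0 < dcoef n) by (apply coef_pos; lra).
  replace (coef a b n) with (coef a b n / dcoef n * dcoef n)
    by (field; lra).
  split; apply Rmult_le_compat_r; lra.
Qed.

Lemma PSeries_bounds_of_coef : forall a b l h x, 0 < a -> 0 < b -> 0 <= x < 1 ->
  (forall n, l <= coef a b n / dcoef n <= h) ->
  l * Kfun x <= PSeries (coef a b) x <= h * Kfun x.
Proof.
  intros a b l h x Ha Hb Hx H.
  assert (Ec : ex_pseries (coef a b) x) by (apply ex_pseries_coef; assumption).
  assert (Es : forall c, ex_pseries (PS_scal c dcoef) x)
    by (intro c; apply ex_pseries_scal; [apply Rmult_comm | apply ex_dcoef, Hx]).
  unfold Kfun. rewrite <- !PSeries_scal. split.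
  - apply PSeries_le; [lra | | apply Es | exact Ec].
    intro n. apply (coef_bounds_of_quotient a b n l h Ha Hb (H n)).
  - apply PSeries_le; [lra | | exact Ec | apply Es].
    intro n. apply (coef_bounds_of_quotient a b n l h Ha Hb (H n)).
Qed.

Lemma coef_quotient_0 : forall a b, coef a b 0 / dcoef 0 = 1.
Proof. intros. rewrite !coef_0. field. Qed.

Lemma coef_quotient_bounds_D1 : forall a b n, D1 a b ->
  PI / Beta a b <= coef a b n / dcoef n <= 1.
Proof.
  intros a b n HD. destruct (HD) as (Ha & Hb & _). split.
  - apply (is_lim_seq_decr_compare (fun n => coef a b n / dcoef n)).
    + apply is_lim_coef_quotient; assumption.
    + intro k. apply coef_quotient_decreasing, HD.
  - apply Rle_trans with (coef a b 0 / dcoef 0);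
      [| rewrite coef_quotient_0; lra].
    apply (decreasing_of_step (fun n => coef a b n / dcoef n)); [|lia].
    intro k. apply coef_quotient_decreasing, HD.
Qed.

Lemma coef_quotient_bounds_D2 : forall a b n, D2 a b ->
  1 <= coef a b n / dcoef n <= PI / Beta a b.
Proof.
  intros a b n HD. destruct (HD) as (Ha & Hb & _). split.
  - apply Rle_trans with (coef a b 0 / dcoef 0);
      [rewrite coef_quotient_0; lra |].
    apply Ropp_le_cancel.
    apply (decreasing_of_step (fun n => - (coef a b n / dcoef n))); [|lia].
    intro k. apply Ropp_le_contravar, coef_quotient_increasing, HD.
  - apply (is_lim_seq_incr_compare (fun n => coef a b n / dcoef n)).
    + apply is_lim_coef_quotient; assumption.
    + intro k. apply coef_quotient_increasing, HD.
Qed.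

Theorem corollary2p3 :
  (forall a b r : R, D1 a b -> 0 < r < 1 ->
     PI / Beta a b * kfun a b r < kfun a b (2 * sqrt r / (1 + r)) < 2 * kfun a b r)
  /\
  (forall a b r : R, D2 a b -> 0 < r < 1 ->
     kfun a b r < kfun a b (2 * sqrt r / (1 + r)) < 2 * PI / Beta a b * kfun a b r).
Proof.
  assert (Harg : forall r, 0 < r < 1 -> (2 * sqrt r / (1 + r)) ^ 2 = 4 * r / (1 + r) ^ 2).
  { intros r Hr. replace (4 * r) with (4 * (sqrt r * sqrt r))
      by (rewrite sqrt_sqrt; lra). field. lra. }
  assert (Hxy : forall r, 0 < r < 1 -> 0 < r ^ 2 < 4 * r / (1 + r) ^ 2 /\ 4 * r / (1 + r) ^ 2 < 1).
  { intros r Hr. pose proof (Landen_arg_bounds r ltac:(lra)).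
    assert (0 < (1 + r) ^ 2) by nra. repeat split; [nra| |lra].
    apply Rmult_lt_reg_r with ((1 + r) ^ 2); [lra|].
    unfold Rdiv. rewrite Rmult_assoc, Rinv_l by lra.
    assert (r * (1 + r) ^ 2 < 4) by nra. nra. }
  assert (HK : forall r, 0 < r < 1 ->
    0 < Kfun (r ^ 2) < Kfun (4 * r / (1 + r) ^ 2) /\
    Kfun (4 * r / (1 + r) ^ 2) < 2 * Kfun (r ^ 2)).
  { intros r Hr. specialize (Hxy r Hr).
    assert (0 < Kfun (r ^ 2)) by (apply Kfun_pos; lra).
    rewrite Landen_transformation by lra. nra. }
  split; intros a b r HD Hr; pose proof HD as (Ha & Hb & _);
    unfold kfun, hypergeom; rewrite Harg by exact Hr;
    change (fun n : nat => poch a n * poch b n / poch (a + b) n / INR (fact n))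
      with (coef a b);
    specialize (Hxy r Hr); specialize (HK r Hr);
    pose proof (Beta_pos a b Ha Hb); pose proof PI_RGT_0;
    assert (0 < PI / Beta a b) by (apply Rdiv_lt_0_compat; lra);
    set (x := r ^ 2) in *; set (y := 4 * r / (1 + r) ^ 2) in *.
  - assert (Bx := PSeries_bounds_of_coef a b _ _ x Ha Hb ltac:(lra)
      (fun n => coef_quotient_bounds_D1 a b n HD)).
    assert (By := PSeries_bounds_of_coef a b _ _ y Ha Hb ltac:(lra)
      (fun n => coef_quotient_bounds_D1 a b n HD)).
    split.
    + (* k(x) <= K(x) < K(y) <= (B/PI) k(y) *)
      nra.
    + assert (Q : PSeries (coef a b) y <= PSeries (coef a b) x / Kfun x * Kfun y).
      { apply PSeries_quotient_decreasing; try (apply ex_pseries_coef; lra); [lra| |].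
        - intro n; apply coef_pos; lra.
        - apply (decreasing_of_step (fun n => coef a b n / dcoef n)).
          intro n. apply coef_quotient_decreasing, HD. }
      assert (P : 0 < PSeries (coef a b) x).
      { apply PSeries_pos; [|lra|apply ex_pseries_coef; lra].
        intro n; apply coef_pos; assumption. }
      assert (0 < PSeries (coef a b) x / Kfun x) by (apply Rdiv_lt_0_compat; lra).
      replace (PSeries (coef a b) x) with (PSeries (coef a b) x / Kfun x * Kfun x)
        by (field; lra).
      nra.
  - assert (Bx := PSeries_bounds_of_coef a b _ _ x Ha Hb ltac:(lra)
      (fun n => coef_quotient_bounds_D2 a b n HD)).
    assert (By := PSeries_bounds_of_coef a b _ _ y Ha Hb ltac:(lra)
      (fun n => coef_quotient_bounds_D2 a b n HD)).
    split.
    + apply PSeries_increasing; [|lra| |]; try (apply ex_pseries_coef; lra).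
      intro n; apply coef_pos; assumption.
    + (* k(y) <= (PI/B) K(y) < (2 PI/B) K(x) <= (2 PI/B) k(x) *)
      replace (2 * PI / Beta a b) with (2 * (PI / Beta a b)) by (field; lra). nra.
Qed.
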